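(* Let $G=(V,E,w)$ be a finite graph with $E\subseteq V\times V$ and nonnegative edge weights $w\in\mathbb{R}_+^E$, let $f:\mathbb{R}^V\to\mathbb{R}$ be differentiable, for each $v\in V$ let $g_v:\mathbb{R}\to\,]-\infty,+\infty]$ be directionally differentiable, and let $$F:\mathbb{R}^V\to\,]-\infty,+\infty],\qquad F(x)=f(x)+\sum_{v\in V}g_v(x_v)+\sum_{(u,v)\in E}w_{(u,v)}|x_u-x_v| .$$ Assume that for every partition $\mathcal{V}$ of $V$ encountered by the cut-pursuit algorithm (defined in the context), the reduced functional $F^{(\mathcal{V})}$ admits a stationary point and the algorithm finds one. Then the cut-pursuit algorithm with set of directions $D=\{-1,0,+1\}^V$ finds a stationary point of $F$: it terminates after finitely many iterations, and the point $x$ it returns is a stationary point of $F$.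
   Context: Directional derivatives. For a real vector space $\Omega$ and $h:\Omega\to\,]-\infty,+\infty]$, $\operatorname{dom}h=\{x\in\Omega\mid h(x)<+\infty\}$. For $x\in\operatorname{dom}h$ and $d\in\Omega$, $h$ admits a directional derivative at $x$ in direction $d$ if $h'(x,d)=\lim_{t\downarrow0}\frac{h(x+td)-h(x)}{t}$ exists in $]-\infty,+\infty]$. $h$ is directionally differentiable if this holds at every point of its domain and in every direction. (Under the hypotheses of the claim, $F$ and the functionals $F^{(\mathcal{V})}$ below are directionally differentiable.) A point $x\in\operatorname{dom}h$ is a stationary point of $h$ if $h'(x,d)\ge0$ for every direction $d$. Reduced problem. For $U\subseteq V$, $1_U\in\mathbb{R}^V$ is the indicator vector of $U$. For a partition $\mathcal{V}$ of $V$, $F^{(\mathcal{V})}:\mathbb{R}^{\mathcal{V}}\to\,]-\infty,+\infty]$ is defined by $F^{(\mathcal{V})}(\xi)=F\big(\sum_{U\in\mathcal{V}}\xi_U1_U\big)$. Cut-pursuit algorithm with set of directions $D\subset\mathbb{R}^V$. Initialize $\mathcal{V}\leftarrow\{V\}$. Repeat: (1) find a stationary point $\xi^{(\mathcal{V})}\in\mathbb{R}^{\mathcal{V}}$ of $F^{(\mathcal{V})}$; (2) set $x\leftarrow\sum_{U\in\mathcal{V}}\xi^{(\mathcal{V})}_U1_U$; (3) find $d^{(x)}\in D$ minimizing $d\mapsto F'(x,d)$ over $D$; (4) set $\mathcal{V}\leftarrow\bigcup_{U\in\mathcal{V}}\{\text{maximal constant connected components of }(d^{(x)}_u)_{u\in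 U}\}$; until $F'(x,d^{(x)})\ge0$. Return $x$. Here the maximal constant connected components of $(d_u)_{u\in U}$ are the maximal subsets of $U$ that are connected in the subgraph of $G$ induced by $U$ (edge orientation ignored) through vertices on which $d$ takes one constant value; equivalently, the connected components of the graph on $U$ whose edges are those $(u,v)\in E\cap(U\times U)$ with $d_u=d_v$. *)

(* Defs.v *)
From HB Require Import structures.
From mathcomp Require Import all_boot all_order all_algebra.
From mathcomp Require Import all_classical all_reals all_analysis.

Set Implicit Arguments.
Unset Strict Implicit.
Unset Printing Implicit Defensive.

Import Order.TTheory GRing.Theory Num.Theory.
Import numFieldNormedType.Exports.

Local Open Scope classical_set_scope.
Local Open Scope ring_scope.

(* Functions valued in ]-oo, +oo] are rendered as functions into \bar R that
   never take the value -oo (an explicit hypothesis where it matters). *)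

Definition edom (R : realType) (Omega : lmodType R) (h : Omega -> \bar R) :
  set Omega := [set x | (h x < +oo)%E].

Definition diff_quotient (R : realType) (Omega : lmodType R)
    (h : Omega -> \bar R) (x d : Omega) (t : R) : \bar R :=
  ((h (x + t *: d)%R - h x) / t%:E)%E.

(* h'(x, d); meaningful when [has_dirder h x d] *)
Definition dirder (R : realType) (Omega : lmodType R)
    (h : Omega -> \bar R) (x d : Omega) : \bar R :=
  lim (diff_quotient h x d t @[t --> 0^'+]).

(* the limit exists in ]-oo, +oo] *)
Definition has_dirder (R : realType) (Omega : lmodType R)
    (h : Omega -> \bar R) (x d : Omega) : Prop :=
  cvg (diff_quotient h x d t @[t --> 0^'+]) /\ (-oo < dirder h x d)%E.

Definition dirdifferentiable (R : realType) (Omega : lmodType R)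
    (h : Omega -> \bar R) : Prop :=
  forall x d : Omega, edom h x -> has_dirder h x d.

Definition stationary (R : realType) (Omega : lmodType R)
    (h : Omega -> \bar R) (x : Omega) : Prop :=
  edom h x /\ forall d : Omega, has_dirder h x d /\ (0 <= dirder h x d)%E.

Definition minimizes (R : realType) (T : Type) (D : set T) (phi : T -> \bar R)
    (d : T) : Prop :=
  D d /\ forall d', D d' -> (phi d <= phi d')%E.

(* R^V is {ffun V -> R}, which carries no topology in the library;
   differentiability is that of normed modules, read through the coordinates
   given by the enumeration of V. *)
Definition ffun_of_row (R : realType) (V : finType) (r : 'rV[R]_#|V|) :
  {ffun V -> R} := [ffun v => r ord0 (enum_rank v)].

Definition differentiable_on_RV (R : realType) (V : finType)
    (f : {ffun V -> R} -> R) : Prop :=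
  forall r : 'rV[R]_#|V|,
    differentiable (fun r' : 'rV[R]_#|V| => f (ffun_of_row r') : R) r.

Definition tv_functional (R : realType) (V : finType) (E : {set V * V})
    (w : V * V -> R) (f : {ffun V -> R} -> R) (g : V -> R -> \bar R)
    (x : {ffun V -> R}) : \bar R :=
  ((f x)%:E + \sum_v g v (x v)
   + (\sum_(e in E) w e * `|x e.1 - x e.2|)%R%:E)%E.

(* R^P for a partition P of V *)
Notation block_vector R P := {ffun {U | U \in P} -> R}.

Definition indicator (R : realType) (V : finType) (U : {set V}) :
  {ffun V -> R} := [ffun v => (v \in U)%:R].

Definition block_sum (R : realType) (V : finType) (P : {set {set V}})
    (xi : block_vector R P) : {ffun V -> R} :=
  \sum_(U : {U | U \in P}) xi U *: indicator R (val U).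

Definition reduced (R : realType) (V : finType) (F : {ffun V -> R} -> \bar R)
    (P : {set {set V}}) (xi : block_vector R P) : \bar R :=
  F (block_sum xi).

Definition same_level_edge (R : realType) (V : finType) (E : {set V * V})
    (d : {ffun V -> R}) (U : {set V}) : rel V :=
  fun u v => [&& u \in U, v \in U, d u == d v
                & ((u, v) \in E) || ((v, u) \in E)].

Definition constant_components (R : realType) (V : finType) (E : {set V * V})
    (d : {ffun V -> R}) (U : {set V}) : {set {set V}} :=
  [set [set v in U | connect (same_level_edge E d U) u v] | u in U]%SET.

Definition split_partition (R : realType) (V : finType) (E : {set V * V})
    (d : {ffun V -> R}) (P : {set {set V}}) : {set {set V}} :=
  (\bigcup_(U in P) constant_components E d U)%SET.

(* One pass through the loop: the current partition, the vector found in
   step (1) and the direction found in step (3). *)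
Record iteration (R : realType) (V : finType) := Iteration {
  blocks : {set {set V}};
  coef : block_vector R blocks;
  direction : {ffun V -> R} }.

Definition current_point (R : realType) (V : finType) (it : iteration R V) :
  {ffun V -> R} := block_sum (coef it).

(* the "until" test *)
Definition stops (R : realType) (V : finType) (F : {ffun V -> R} -> \bar R)
    (it : iteration R V) : bool :=
  (0 <= dirder F (current_point it) (direction it))%E.

(* Executions are indexed by all of nat; the k-th iteration actually takes
   place when [reached F run k], and the other entries of [run] are irrelevant. *)
Definition reached (R : realType) (V : finType) (F : {ffun V -> R} -> \bar R)
    (run : nat -> iteration R V) (k : nat) : Prop :=
  forall j, (j < k)%N -> ~~ stops F (run j).

(* Steps (2)-(4) of each iteration; that step (1) succeeds is the separate
   condition [solves_reduced]. *)
Definition cut_pursuit_run (R : realType) (V : finType) (E : {set V * V})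
    (D : set {ffun V -> R}) (F : {ffun V -> R} -> \bar R)
    (run : nat -> iteration R V) : Prop :=
  blocks (run 0%N) = [set [set: V]]%SET /\
  forall k, reached F run k ->
    minimizes D (dirder F (current_point (run k))) (direction (run k)) /\
    blocks (run k.+1) = split_partition E (direction (run k)) (blocks (run k)).

Definition solves_reduced (R : realType) (V : finType)
    (F : {ffun V -> R} -> \bar R) (run : nat -> iteration R V) : Prop :=
  forall k, reached F run k ->
    stationary (@reduced R V F (blocks (run k))) (coef (run k)).

Definition terminates_at (R : realType) (V : finType)
    (F : {ffun V -> R} -> \bar R) (run : nat -> iteration R V) (N : nat) : Prop :=
  reached F run N /\ stops F (run N).

Definition ternary (R : realType) (V : finType) : set {ffun V -> R} :=
  [set d : {ffun V -> R} | forall v : V, d v \in [:: -1; 0; 1]].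

(* Main.v *)
(* The map d |-> F'(x, d) is positively homogeneous, and additive on pairs of
   directions that agree in sign coordinatewise; slicing d into its level sets
   thus shows that nonnegativity of F'(x, .) on {-1, 0, 1}^V implies
   nonnegativity everywhere.  For termination, a step that does not refine the
   partition has a direction constant on every block, along which F'(x, .) >= 0
   by stationarity of the reduced functional, so the algorithm stops; otherwise
   the number of pairs of vertices sharing a block drops. *)
Require Import Defs.
From HB Require Import structures.
From mathcomp Require Import all_boot all_order all_algebra.
From mathcomp Require Import ring lra.
From mathcomp Require Import all_classical all_reals all_analysis.
Import Order.TTheory GRing.Theory Num.Theory.
Import numFieldNormedType.Exports.
Local Open Scope classical_set_scope.
Local Open Scope ring_scope.

(** * Calculus of directional derivatives with values in ]-oo, +oo] *)

Lemma diff_quotientD (R : realType) (Omega : lmodType R)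
    (h1 h2 : Omega -> \bar R) (x d : Omega) (t : R) :
  h1 x \is a fin_num -> h2 x \is a fin_num ->
  (-oo < h1 (x + t *: d)%R)%E -> (-oo < h2 (x + t *: d)%R)%E -> 0 < t ->
  diff_quotient (fun y => h1 y + h2 y)%E x d t =
  (diff_quotient h1 x d t + diff_quotient h2 x d t)%E.
Proof.
rewrite /diff_quotient => h1x h2x h1d h2d t0.
rewrite -(fineK h1x) -(fineK h2x) inver gt_eqF//.
have ti0 : (0 < t^-1%:E)%E by rewrite lte_fin invr_gt0.
move: (fine _) (fine _) => a b.
(* Values at [x + t *: d] are real or +oo, and those at [x] are real, so the sum never meets +oo -
   oo in any of the four cases. *)
case: (h1 _) h1d => [p| |]// _; case: (h2 _) h2d => [q| |]// _.
- by rewrite -!EFinD -EFinM; congr EFin; ring.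
- by rewrite -!EFinD -?EFinB !addye// gt0_mulye// -EFinM addey.
- by rewrite -!EFinD -?EFinB !addye// gt0_mulye// -EFinM addye.
- by rewrite -!EFinD !addye// gt0_mulye.
Qed.

Lemma cvg_diff_quotientD (R : realType) (Omega : lmodType R)
    (h1 h2 : Omega -> \bar R) (x d : Omega) (l1 l2 : \bar R) :
  (forall y, -oo < h1 y)%E -> (forall y, -oo < h2 y)%E ->
  edom h1 x -> edom h2 x -> (-oo < l1)%E -> (-oo < l2)%E ->
  diff_quotient h1 x d t @[t --> 0^'+] --> l1 ->
  diff_quotient h2 x d t @[t --> 0^'+] --> l2 ->
  diff_quotient (fun y => h1 y + h2 y)%E x d t @[t --> 0^'+] --> (l1 + l2)%E.
Proof.
move=> h1N h2N h1x h2x l1N l2N c1 c2.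
have l12 : (l1 +? l2)%E by case: l1 l1N {c1} => //; case: l2 l2N {c2}.
apply: cvg_trans (cvgeD l12 c1 c2); apply: near_eq_cvg.
near=> t; rewrite /= diff_quotientD//.
- by rewrite fin_numE -ltNye -ltey h1N.
- by rewrite fin_numE -ltNye -ltey h2N.
Unshelve. all: by end_near. Qed.

Lemma sume_gtNy (R : realType) (I : Type) (s : seq I) (P : pred I)
    (h : I -> \bar R) :
  (forall i, P i -> -oo < h i)%E -> (-oo < \sum_(i <- s | P i) h i)%E.
Proof.
by move=> hN; elim/big_ind : _ => // -[a| |] [b| |] //= _ _; rewrite ltNyr.
Qed.

Lemma sume_lty (R : realType) (I : Type) (s : seq I) (P : pred I)
    (h : I -> \bar R) :
  (forall i, P i -> h i < +oo)%E -> (\sum_(i <- s | P i) h i < +oo)%E.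
Proof.
by move=> hy; elim/big_ind : _ => // a b ay by_; exact: lte_add_pinfty.
Qed.

Lemma cvg_diff_quotient_sum (R : realType) (Omega : lmodType R) (I : Type)
    (s : seq I) (P : pred I) (h : I -> Omega -> \bar R) (x d : Omega)
    (l : I -> \bar R) :
  (forall i y, P i -> -oo < h i y)%E -> (forall i, P i -> edom (h i) x) ->
  (forall i, P i -> -oo < l i)%E ->
  (forall i, P i -> diff_quotient (h i) x d t @[t --> 0^'+] --> l i) ->
  diff_quotient (fun y => \sum_(i <- s | P i) h i y)%E x d t @[t --> 0^'+] -->
  (\sum_(i <- s | P i) l i)%E.
Proof.
move=> hN hx lN hl; elim: s => [|i s IH].
  rewrite big_nil; apply: cvg_near_cst; near=> t.
  by rewrite /diff_quotient !big_nil sube0 mul0e.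
rewrite big_cons; under eq_fun do under eq_fun do rewrite big_cons.
case: ifPn => // Pi; apply: cvg_diff_quotientD => //.
- by move=> y; exact: hN.
- by move=> y; apply: sume_gtNy => j; exact: hN.
- exact: hx.
- by apply: sume_lty => j; exact: hx.
- exact: lN.
- by apply: sume_gtNy => j; exact: lN.
- exact: hl.
Unshelve. all: by end_near. Qed.

Lemma cvg_right0Z (R : realType) (c : R) : 0 < c ->
  c * t @[t --> 0^'+] --> (0 : R)^'+.
Proof.
move=> c0 A [e /= e0 eA]; exists (e / c) => /=; first exact: divr_gt0.
move=> t /= te t0; apply: eA => /=; last exact: mulr_gt0.
move: te; rewrite !sub0r !normrN normrM (gtr0_norm c0).
by rewrite ltr_pdivlMr// mulrC.
Qed.

(** For [c > 0], substituting [c * t] for [t] turns the quotient along [d] into the one along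
    [c *: d], up to the factor [c]. For [c = 0] the quotient is identically 0, which matches the
    convention 0 * +oo = 0. *)
Lemma dirderZ (R : realType) (Omega : lmodType R) (h : Omega -> \bar R)
    (x d : Omega) (c : R) :
  h x \is a fin_num -> has_dirder h x d -> 0 <= c ->
  dirder h x (c *: d) = (c%:E * dirder h x d)%E.
Proof.
move=> hx [hcvg _]; rewrite le_eqVlt => /orP[/eqP<-|c0].
  rewrite mul0e; apply/cvg_lim => //; apply: cvg_near_cst; near=> t.
  by rewrite /diff_quotient scale0r scaler0 addr0 subee// mul0e.
apply/cvg_lim => //.
have /cvgeZl-/(_ c%:E isT) := cvg_comp _ _ (cvg_right0Z _ c c0) hcvg.
apply: cvg_trans; apply: near_eq_cvg; near=> t.
have t0 : 0 < t by [].
rewrite /= /diff_quotient !inver !gt_eqF ?mulr_gt0// scalerA (mulrC t c).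
rewrite muleCA -EFinM; congr (_ * _%:E)%E.
by rewrite invfM mulrA mulfV ?gt_eqF// mul1r.
Unshelve. all: by end_near. Qed.

(** * One-sided derivative of the absolute value at [a] along [b] *)

Definition abs_dirder {R : realType} (a b : R) : R :=
  if a == 0 then `|b| else Num.sg a * b.

(** The absolute value is piecewise linear, so the expansion is exact for small [t]: once
    [|t * b| < |a|], the sign of [a + t * b] is that of [a]. *)
Lemma abs_dirderE (R : realType) (a b : R) :
  \forall t \near 0^'+, `|a + t * b| - `|a| = t * abs_dirder a b.
Proof.
rewrite /abs_dirder; have [->|a0] := eqVneq a 0.
  by near=> t; rewrite add0r normr0 subr0 normrM gtr0_norm.
(* The summand 1 keeps the divisor positive when [b = 0]. *)
have b1 : 0 < `|b| + 1 by rewrite ltr_wpDl.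
have tb : \forall t \near 0^'+, `|t * b| < `|a|.
  have e0 : 0 < `|a| / (`|b| + 1) by rewrite divr_gt0// normr_gt0.
  near=> t; have t0 : 0 < t by [].
  have te : t < `|a| / (`|b| + 1) by near: t; exact: nbhs_right_lt.
  rewrite normrM (gtr0_norm t0); apply: le_lt_trans (_ : t * (`|b| + 1) < _).
    by rewrite ler_pM2l// lerDl.
  by rewrite -ltr_pdivlMr.
near=> t; have : `|t * b| < `|a| by near: t; exact: tb.
case: (ltrgt0P a) a0 => // a0 _; rewrite ltr_norml => /andP[tb1 tb2].
  by rewrite gtr0_norm ?gtr0_sg//; lra.
by rewrite ltr0_norm ?ltr0_sg//; lra.
Unshelve. all: by end_near. Qed.

(** * Directional derivative of the full functional *)

Lemma ffun_of_row_linear (R : realType) (V : finType) (a : R)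
    (r s : 'rV[R]_#|V|) :
  ffun_of_row (r + a *: s) = ffun_of_row r + a *: ffun_of_row s.
Proof. by apply/ffunP => v; rewrite !ffunE !mxE. Qed.

Lemma differentiable_on_RV_cvg (R : realType) (V : finType)
    (f : {ffun V -> R} -> R) (x : {ffun V -> R}) : differentiable_on_RV f ->
  exists L : {ffun V -> R} -> R,
    (forall (a : R) u v, L (a *: u + v) = a * L u + L v) /\
    forall d, diff_quotient (EFin \o f) x d t @[t --> 0^'+] --> (L d)%:E.
Proof.
move=> fdiff.
pose row_of (y : {ffun V -> R}) : 'rV[R]_#|V| := \row_i y (enum_val i).
have rowK y : ffun_of_row (row_of y) = y.
  by apply/ffunP => v; rewrite !ffunE mxE enum_rankK.
pose f' (r : 'rV[R]_#|V|) : R := f (ffun_of_row r).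
exists (fun d => 'd f' (row_of x) (row_of d)); split=> [a u v|d].
  rewrite -linearPZ; congr ('d _ _ _).
  by apply/rowP => i; rewrite !mxE !ffunE.
have fx : differentiable f' (row_of x) by exact: fdiff.
have : (h^-1 *: (f' (h *: row_of d + row_of x) - f' (row_of x)) : R)
    @[h --> (0 : R)^'+] --> ('d f' (row_of x) (row_of d) : R).
  (* The two-sided derivative along [row_of d] restricts to [h > 0]. *)
  apply: cvg_dnbhs_at_right; rewrite -deriveE//.
  exact: (diff_derivable (v := row_of d) fx).
move=> fd; apply: cvg_EFin.
  by near=> t; rewrite /diff_quotient /= inver gt_eqF.
apply: cvg_trans fd; apply: near_eq_cvg; near=> t.
rewrite /diff_quotient /= inver gt_eqF//=.
by rewrite /f' (addrC (t *: _)) ffun_of_row_linear !rowK [RHS]mulrC.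
Unshelve. all: by end_near. Qed.

Lemma edom_tv_functional (R : realType) (V : finType) (E : {set V * V})
    (w : V * V -> R) (f : {ffun V -> R} -> R) (g : V -> R -> \bar R)
    (x : {ffun V -> R}) (v : V) :
  (forall v r, -oo < g v r)%E -> edom (tv_functional E w f g) x ->
  edom (g v) (x v).
Proof.
move=> gN; rewrite /edom /tv_functional /= !ltey; apply: contra_neq => gv.
suff -> : (\sum_v g v (x v) = +oo)%E by rewrite addey.
apply/esum_eqyP => [u _|]; first by rewrite -ltNye.
by exists v; split.
Qed.

(** [L] is chosen before [d], so that one linear map serves all directions and can later be expanded
    on a sum of directions. The formula is obtained term by term; each term has a limit above -oo,
    so the sums of limits are well defined. *)
Lemma dirder_tv_functional (R : realType) (V : finType) (E : {set V * V})
    (w : V * V -> R) (f : {ffun V -> R} -> R) (g : V -> R -> \bar R)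
    (x : {ffun V -> R}) :
  differentiable_on_RV f -> (forall v r, -oo < g v r)%E ->
  (forall v, dirdifferentiable (g v)) -> edom (tv_functional E w f g) x ->
  exists L : {ffun V -> R} -> R,
    (forall (a : R) u v, L (a *: u + v) = a * L u + L v) /\
    forall d, has_dirder (tv_functional E w f g) x d /\
      dirder (tv_functional E w f g) x d =
      ((L d)%:E + \sum_v dirder (g v) (x v) (d v)
       + (\sum_(e in E)
            w e * abs_dirder (x e.1 - x e.2) (d e.1 - d e.2))%R%:E)%E.
Proof.
move=> fdiff gN gdd Fx.
have gx v : edom (g v) (x v) by exact: edom_tv_functional Fx.
have [L [Llin Lf]] := differentiable_on_RV_cvg _ _ _ x fdiff.
exists L; split=> // d.
have SN : (-oo < (L d)%:E + \sum_v dirder (g v) (x v) (d v))%E.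
  have := @sume_gtNy R V (index_enum V) xpredT
    (fun v => dirder (g v) (x v) (d v)) (fun v _ => (gdd v _ (d v) (gx v)).2).
  by case: (\sum_v _)%E => // r _; rewrite -EFinD ltNyr.
have sgN y : (-oo < \sum_v g v (y v : R))%E by apply: sume_gtNy.
have FD : diff_quotient (tv_functional E w f g) x d t @[t --> 0^'+] -->
   ((L d)%:E + \sum_v dirder (g v) (x v) (d v)
     + (\sum_(e in E)
         w e * abs_dirder (x e.1 - x e.2) (d e.1 - d e.2))%R%:E)%E.
  rewrite /tv_functional -sumEFin.
  under [X in diff_quotient X]eq_fun do rewrite -sumEFin.
  have fgN y : (-oo < (f y)%:E + \sum_v g v (y v : R))%E.
    by have := sgN y; case: (\sum_v _)%E => // r _; rewrite -EFinD ltNyr.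
  have sgx : (\sum_v g v (x v) < +oo)%E by apply: sume_lty => v _; exact: gx.
  apply: cvg_diff_quotientD => //.
  - by move=> y; rewrite sumEFin ltNyr.
  - by rewrite /edom /=; apply: lte_add_pinfty => //; exact: ltry.
  - by rewrite /edom /= sumEFin ltry.
  - by rewrite sumEFin ltNyr.
  - apply: cvg_diff_quotientD => //.
    + by move=> y; exact: ltNyr.
    + exact: ltry.
    + exact: ltNyr.
    + by apply: sume_gtNy => v _; exact: (gdd v _ (d v) (gx v)).2.
    + apply: cvg_diff_quotient_sum => // [v _|v _|v _]; first exact: gx.
        exact: (gdd v _ (d v) (gx v)).2.
      have := (gdd v _ (d v) (gx v)).1.
      apply: cvg_trans; apply: near_eq_cvg; near=> t.
      by rewrite /diff_quotient !ffunE.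
  - apply: cvg_diff_quotient_sum => [e y _|e _|e _|e _].
    + exact: ltNyr.
    + exact: ltry.
    + exact: ltNyr.
    (* By [abs_dirderE] an edge quotient is eventually constant. *)
    apply: cvg_near_cst; near=> t.
    have t0 : 0 < t by [].
    rewrite /diff_quotient inver gt_eqF// -EFinB -EFinM -mulrBr !ffunE.
    have -> : x e.1 + t *: d e.1 - (x e.2 + t *: d e.2) =
              x e.1 - x e.2 + t * (d e.1 - d e.2).
      by rewrite /GRing.scale /=; ring.
    congr (_%:E).
    rewrite (_ : `|_ + _| - _ =
      t * abs_dirder (x e.1 - x e.2) (d e.1 - d e.2)).
      by field; rewrite gt_eqF.
    by near: t; exact: abs_dirderE.
have FE := cvg_lim (@ereal_hausdorff R) FD.
split; last exact: FE.
split; first by apply/cvg_ex; eexists; exact: FD.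
rewrite /dirder FE; move: SN; case: (_ + _)%E => // r _.
by rewrite -EFinD ltNyr.
Unshelve. all: by end_near. Qed.

(** * From ternary directions to all directions *)

Lemma abs_dirder_sign_split (R : realType) (c m : R) (s s' a a' : R) :
  0 <= m -> 0 <= a -> 0 <= a' -> s \in [:: -1; 0; 1] -> s' \in [:: -1; 0; 1] ->
  abs_dirder c ((m + a) * s - (m + a') * s') =
  m * abs_dirder c (s - s') + abs_dirder c (a * s - a' * s').
Proof.
move=> m0 a0 a'0; rewrite /abs_dirder !inE => hs hs'.
(* Away from the kink, [abs_dirder c] is linear. *)
case: ifP => _; last by ring.
rewrite -[m in m * `|_|]ger0_norm// -normrM.
(* At the kink, additivity of the absolute value requires [s - s'] and [a * s - a' * s'] not to have
   opposite signs. This holds because [s' < s] forces [s' <= 0 <= s], and symmetrically. *)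
by move: hs hs' => /or3P[]/eqP-> /or3P[]/eqP->;
  do 3 (case: ler0P => ?); lra.
Qed.

(** The directions with coordinates [m * s v] and [a v * s v] agree in sign at each vertex. [L] is
    linear, each [g v] is handled by positive homogeneity along the ray of [s v], and each edge by
    [abs_dirder_sign_split]. *)
Lemma dirder_tv_functional_split (R : realType) (V : finType) (E : {set V * V})
    (w : V * V -> R) (f : {ffun V -> R} -> R) (g : V -> R -> \bar R)
    (x s : {ffun V -> R}) (m : R) (a : V -> R) :
  differentiable_on_RV f -> (forall v r, -oo < g v r)%E ->
  (forall v, dirdifferentiable (g v)) -> edom (tv_functional E w f g) x ->
  0 < m -> (forall v, 0 <= a v) -> ternary s ->
  dirder (tv_functional E w f g) x [ffun v => (m + a v) * s v] =
  (m%:E * dirder (tv_functional E w f g) x s +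
   dirder (tv_functional E w f g) x [ffun v => (a v * s v)%R])%E.
Proof.
move=> fdiff gN gdd Fx m0 a0 ts.
have gx v : edom (g v) (x v) by exact: edom_tv_functional Fx.
have gxfin v : g v (x v) \is a fin_num.
  by rewrite fin_numE -ltNye -ltey gN gx.
have [L [Llin dF]] := dirder_tv_functional _ _ _ _ _ _ _ fdiff gN gdd Fx.
rewrite !(dF _).2.
pose G v r := dirder (g v) (x v) r.
have GN v r : (-oo < G v r)%E by exact: (gdd v _ r (gx v)).2.
have GZ v c : 0 <= c -> G v (c * s v) = (c%:E * G v (s v))%E.
  by move=> c0; rewrite /G (dirderZ _ _ _ _ (s v))//; exact: gdd.
have -> : (\sum_v dirder (g v) (x v) ([ffun v => ((m + a v) * s v)%R] v) =
    m%:E * (\sum_v G v (s v)) +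
    \sum_v dirder (g v) (x v) ([ffun v => (a v * s v)%R] v))%E.
  rewrite fin_num_sume_distrr//; last first.
    move=> u v _ _; have := GN u (s u); have := GN v (s v).
    by case: (G u _) => //; case: (G v _).
  rewrite -big_split; apply: eq_bigr => v _ /=; rewrite !ffunE -!/(G _ _).
  rewrite !GZ ?addr_ge0 ?(ltW m0)//.
  case: (G v (s v)) (GN v (s v)) => [r| |]// _.
    by rewrite -!EFinM -EFinD mulrDl.
  (* If the derivative of [g v] is +oo, then [m > 0] makes both sides +oo, even when [a v = 0]
     contributes 0 * +oo = 0. *)
  rewrite gt0_muley ?lte_fin ?ltr_wpDr// gt0_muley ?lte_fin//.
  by have := a0 v; rewrite le_eqVlt => /orP[/eqP<-|av0];
    rewrite ?mul0e ?addye// gt0_muley ?lte_fin.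
have -> : [ffun v => (m + a v) * s v] = m *: s + [ffun v => a v * s v].
  by apply/ffunP => v; rewrite !ffunE mulrDl.
rewrite Llin.
have -> : \sum_(e in E) w e * abs_dirder (x e.1 - x e.2)
      ((m *: s + [ffun v => a v * s v])%R e.1 -
       (m *: s + [ffun v => a v * s v])%R e.2) =
    m * (\sum_(e in E) w e * abs_dirder (x e.1 - x e.2) (s e.1 - s e.2)) +
    \sum_(e in E) w e * abs_dirder (x e.1 - x e.2)
      ([ffun v => a v * s v] e.1 - [ffun v => a v * s v] e.2).
  rewrite mulr_sumr -big_split; apply: eq_bigr => e _ /=; rewrite !ffunE.
  rewrite -!mulrDl abs_dirder_sign_split ?(ltW m0)//; ring.
set A := \sum_(e in E) _; set B := \sum_(e in E) _.
set T := (\sum_v dirder _ _ _)%E; set S := (\sum_v G v (s v))%E.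
have SN : (-oo < S)%E by exact: sume_gtNy.
have TN : (-oo < T)%E.
  by apply: sume_gtNy => v _; exact: (gdd v _ _ (gx v)).2.
have mE : (0 < m%:E)%E by rewrite lte_fin.
case: S SN => [S| |]// _; case: T TN => [T| |]// _.
- by rewrite -!(EFinM, EFinD); congr EFin; ring.
- by rewrite !(addey, addye)// gt0_muley// !(addey, addye).
- by rewrite !(addey, addye)// gt0_muley// !(addey, addye).
Qed.

(* With [m] the least nonzero [`|d v|] and [s] the sign vector of [d],
   [d = m *: s + d'] where [d'] has smaller support and the signs of [s]. *)
Lemma dirder_tv_functional_ge0 (R : realType) (V : finType) (E : {set V * V})
    (w : V * V -> R) (f : {ffun V -> R} -> R) (g : V -> R -> \bar R)
    (x : {ffun V -> R}) :
  differentiable_on_RV f -> (forall v r, -oo < g v r)%E ->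
  (forall v, dirdifferentiable (g v)) -> edom (tv_functional E w f g) x ->
  (forall s, ternary s -> 0 <= dirder (tv_functional E w f g) x s)%E ->
  forall d, (0 <= dirder (tv_functional E w f g) x d)%E.
Proof.
move=> fdiff gN gdd Fx Fs d.
have [n] := ubnP #|[set v | d v != 0]%SET|; elim: n d => // n IH d.
rewrite ltnS => dn.
have [v0 dv0|d0] := pickP [pred v | d v != 0]; last first.
  (* With empty support, [d] is zero, hence itself ternary. *)
  by apply: Fs => v; have := d0 v; rewrite /= => /negbFE/eqP->;
    rewrite !inE eqxx orbT.
case: (Order.TotalTheory.arg_minP (fun v => `|d v|) dv0) => /= u du umin.
pose m := `|d u|; pose s : {ffun V -> R} := [ffun v => Num.sg (d v)].
(* Off the support [|d v| - m] would be negative; [s v = 0] there, so the value 0 can be taken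
   instead. *)
pose a v := if d v == 0 then 0 else `|d v| - m.
have m0 : 0 < m by rewrite normr_gt0.
have a0 v : 0 <= a v by rewrite /a; case: ifPn => // dv; rewrite subr_ge0 umin.
have ts : ternary s.
  by move=> v; rewrite ffunE !inE; case: sgrP; rewrite eqxx ?orbT.
have -> : d = [ffun v => (m + a v) * s v].
  apply/ffunP => v; rewrite !ffunE /a.
  have [->|dv] := eqVneq (d v) 0; first by rewrite sgr0 mulr0.
  by rewrite addrC subrK mulrC -numEsg.
rewrite dirder_tv_functional_split//.
apply: adde_ge0; first by rewrite mule_ge0 ?lee_fin ?(ltW m0)// Fs.
apply: IH; apply: leq_trans dn; apply/proper_card/properP; split.
  apply/fintype.subsetP => v; rewrite !inE !ffunE /a; apply: contra_neq => ->.
  by rewrite eqxx mul0r.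
(* The minimum is attained at [u], so [a u = 0] and [u] leaves the support. *)
by exists u; rewrite !inE ?ffunE ?negbK// /a (negbTE du) subrr mul0r.
Qed.

(** * Block vectors and the reduced functional *)

Lemma block_sumE (R : realType) (V : finType) (P : {set {set V}})
    (xi : {ffun {U | U \in P} -> R}) (v : V) (U : {U | U \in P}) :
  finset.trivIset P -> v \in val U -> block_sum xi v = xi U.
Proof.
move=> tiP vU; rewrite /block_sum sum_ffunE (bigD1 U)//= !ffunE vU.
rewrite [_ *: _]mulr1 big1 ?addr0// => W WU; rewrite !ffunE.
have [vW|_] := boolP (v \in val W); last exact: scaler0.
case/eqP: WU; apply: val_inj.
rewrite -(finset.def_pblock tiP (valP W) vW).
by rewrite (finset.def_pblock tiP (valP U) vU).
Qed.

Lemma block_sum_linear (R : realType) (V : finType) (P : {set {set V}})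
    (xi delta : {ffun {U | U \in P} -> R}) (t : R) :
  block_sum (xi + t *: delta) = block_sum xi + t *: block_sum delta.
Proof.
rewrite /block_sum scaler_sumr -big_split; apply: eq_bigr => U _ /=.
by rewrite !ffunE scalerDl scalerA.
Qed.

(** Since [block_sum] is linear, both difference quotients are the same function of [t], so their
    limits agree whether or not they converge. *)
Lemma reduced_dirder (R : realType) (V : finType) (F : {ffun V -> R} -> \bar R)
    (P : {set {set V}}) (xi delta : {ffun {U | U \in P} -> R}) :
  dirder (@reduced R V F P) xi delta =
  dirder F (block_sum xi) (block_sum delta).
Proof.
rewrite /dirder (_ : diff_quotient _ xi delta =
  diff_quotient F (block_sum xi) (block_sum delta))//.
by apply/funext => t; rewrite /diff_quotient /reduced block_sum_linear.
Qed.

(** * Refinement of partitions by constant components *)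

Lemma same_level_edge_connect_eq (R : realType) (V : finType) (E : {set V * V})
    (d : {ffun V -> R}) (U : {set V}) (u v : V) :
  connect (same_level_edge E d U) u v -> d u = d v.
Proof.
have cl : fingraph.closed (same_level_edge E d U) [pred z | d z == d u].
  by move=> y z /and4P[_ _ /eqP yz _]; rewrite !inE yz.
by move=> /(closed_connect cl); rewrite !inE eqxx => /esym/eqP.
Qed.

Lemma same_level_edge_connect_sym (R : realType) (V : finType)
    (E : {set V * V}) (d : {ffun V -> R}) (U : {set V}) :
  connect_sym (same_level_edge E d U).
Proof.
apply: sym_connect_sym => u v; rewrite /same_level_edge eq_sym.
rewrite [X in _ = X]andbCA.
by rewrite [X in [&& _, _, _ & X]]orbC.
Qed.

Lemma constant_components_partition (R : realType) (V : finType)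
    (E : {set V * V}) (d : {ffun V -> R}) (U : {set V}) :
  finset.partition (constant_components E d U) U.
Proof.
apply: equivalence_partitionP => x y z _ _ _; split; first exact: connect0.
move=> xy; exact: same_connect (same_level_edge_connect_sym _ _ _ _ _) _ _ xy z.
Qed.

(** This is the inductive step of the loop invariant. A vertex common to two components lies in both
    parent blocks, which therefore coincide, and components of a single block are disjoint. *)
Lemma split_partitionP (R : realType) (V : finType) (E : {set V * V})
    (d : {ffun V -> R}) (P : {set {set V}}) :
  finset.cover P = [set: V]%SET -> finset.trivIset P ->
  finset.cover (split_partition E d P) = [set: V]%SET /\
  finset.trivIset (split_partition E d P).
Proof.
move=> covP tiP; have cc := constant_components_partition R V E d.
split.
- apply/eqP; rewrite finset.eqEsubset finset.subsetT/=.
  apply/fintype.subsetP => v _.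
  have : v \in finset.cover P by rewrite covP inE.
  move=> /finset.bigcupP[U UP]; rewrite -{1}(finset.cover_partition (cc U)).
  move=> /finset.bigcupP[B BU vB]; apply/finset.bigcupP; exists B => //.
  by apply/finset.bigcupP; exists U.
- apply/finset.trivIsetP => A B.
  move=> /finset.bigcupP[U UP AU] /finset.bigcupP[W WP BW].
  apply: contra_neqT => /pred0Pn[z /andP[/= zA zB]].
  have zU : z \in U.
    by rewrite -(finset.cover_partition (cc U)); apply/finset.bigcupP; exists A.
  have zW : z \in W.
    by rewrite -(finset.cover_partition (cc W)); apply/finset.bigcupP; exists B.
  have UW : U = W.
    by rewrite -(finset.def_pblock tiP UP zU) (finset.def_pblock tiP WP zW).
  have /and3P[_ tiU _] := cc U; rewrite -UW in BW.
  by rewrite -(finset.def_pblock tiU AU zA) (finset.def_pblock tiU BW zB).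
Qed.

(** The equivalence relation of a partition as a set of pairs: refinement becomes inclusion, and its
    cardinality is the termination measure. *)
Definition same_block_pairs {V : finType} (P : {set {set V}}) : {set V * V} :=
  [set p | [exists U in P, (p.1 \in U) && (p.2 \in U)]]%SET.

Lemma split_partition_pairs_sub (R : realType) (V : finType) (E : {set V * V})
    (d : {ffun V -> R}) (P : {set {set V}}) :
  same_block_pairs (split_partition E d P) \subset same_block_pairs P.
Proof.
apply/fintype.subsetP => -[u v]; rewrite !inE /=.
move=> /exists_inP[B /finset.bigcupP[U UP /imsetP[z _ ->]]].
rewrite !inE => /andP[/andP[uU _] /andP[vU _]].
by apply/exists_inP; exists U => //; rewrite uU.
Qed.

(** The pair [(u, v)] is lost: in a common component both would be connected to the same [z] through
    edges on which [d] is constant. *)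
Lemma split_partition_pairs_proper (R : realType) (V : finType)
    (E : {set V * V}) (d : {ffun V -> R}) (P : {set {set V}}) (U : {set V})
    (u v : V) :
  U \in P -> u \in U -> v \in U -> d u != d v ->
  same_block_pairs (split_partition E d P) \proper same_block_pairs P.
Proof.
move=> UP uU vU duv; apply/fintype.properP; split.
  exact: split_partition_pairs_sub.
exists (u, v); rewrite inE /=.
  by apply/exists_inP; exists U => //; rewrite uU.
apply: contra duv => /exists_inP[B /finset.bigcupP[W WP /imsetP[z _ ->]]].
rewrite !inE => /andP[/andP[_ zu] /andP[_ zv]].
by rewrite -(same_level_edge_connect_eq _ _ _ _ _ _ _ zu)
           -(same_level_edge_connect_eq _ _ _ _ _ _ _ zv).
Qed.

Lemma block_constant_block_sum (R : realType) (V : finType) (P : {set {set V}})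
    (d : {ffun V -> R}) :
  finset.cover P = [set: V]%SET -> finset.trivIset P ->
  (forall U u v, U \in P -> u \in U -> v \in U -> d u = d v) ->
  exists delta : {ffun {U | U \in P} -> R}, d = block_sum delta.
Proof.
move=> covP tiP dP.
(* The default 0 is for an empty block, as in the initial partition when [V] is empty. *)
pose rep (U : {U | U \in P}) := if [pick u in val U] is Some u then d u else 0.
exists (finfun rep).
apply/ffunP => v; have : v \in finset.cover P by rewrite covP inE.
move=> /finset.bigcupP[U UP vU].
rewrite (block_sumE _ _ _ _ _ (exist _ U UP))// ffunE /rep /=.
by case: pickP => [u uU|/(_ v)]; [exact: (dP U)|rewrite vU].
Qed.

(** * Minimization over the ternary directions *)

Lemma finite_minimizer (R : realType) (T : finType) (S : Type) (h : T -> S)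
    (D : set S) (phi : S -> \bar R) (t0 : T) :
  (forall t, D (h t)) -> (forall s, D s -> exists t, s = h t) ->
  exists s, minimizes D phi s.
Proof.
move=> Dh hD.
case: (@Order.TotalTheory.arg_minP _ _ _ t0 xpredT (phi \o h) isT) => t _ tmin.
exists (h t); split=> // _ /hD[t' ->]; exact: tmin.
Qed.

Lemma ternary_minimizer (R : realType) (V : finType)
    (phi : {ffun V -> R} -> \bar R) :
  exists d, minimizes (@ternary R V) phi d.
Proof.
(* A ternary direction is coded by digits 0, 1, 2, shifted by -1, so that the minimum is taken over
   a finite type. *)
apply: (finite_minimizer R {ffun V -> 'I_3} _
  (fun c => [ffun v => (c v)%:R - 1]) _ _ [ffun=> ord0]) => [c v|d td].
  rewrite ffunE !inE; case: (c v) => -[|[|[|//]]] ? /=.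
  - by rewrite sub0r eqxx.
  - by rewrite subrr eqxx orbT.
  - by rewrite (_ : 2%:R - 1 = 1 :> R) ?eqxx ?orbT//; ring.
exists [ffun v => if d v == -1 then inord 0 else
                  if d v == 0 then inord 1 else inord 2].
apply/ffunP => v; rewrite !ffunE.
have := td v; rewrite !inE.
case: eqP => [->|_]; first by rewrite inordK// sub0r.
case: eqP => [->|_]; first by rewrite inordK// subrr.
by move=> /= /eqP->; rewrite inordK//; ring.
Qed.

(** * Runs of the algorithm: invariant, termination and correctness *)

Lemma run_partition (R : realType) (V : finType) (E : {set V * V})
    (D : set {ffun V -> R}) (F : {ffun V -> R} -> \bar R)
    (run : nat -> iteration R V) (k : nat) :
  cut_pursuit_run E D F run -> reached F run k ->
  finset.cover (blocks (run k)) = [set: V]%SET /\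
  finset.trivIset (blocks (run k)).
Proof.
move=> [run0 runS]; elim: k => [_|k IH rk].
  rewrite run0; split.
  - by rewrite /finset.cover big_set1.
  - by apply/finset.trivIsetP => A B /set1P-> /set1P->; rewrite eqxx.
have rk' : reached F run k by move=> j jk; apply: rk; exact: ltnW.
by rewrite (runS k rk').2; have [] := IH rk'; exact: split_partitionP.
Qed.

(* The first conjunct says that step (3) can always be carried out, so that
   runs exist as soon as step (1) succeeds. *)
Theorem corollary2p1 (R : realType) (V : finType) (E : {set V * V})
    (w : V * V -> R) (w_ge0 : forall e, e \in E -> 0 <= w e)
    (f : {ffun V -> R} -> R) (f_diff : differentiable_on_RV f)
    (g : V -> R -> \bar R)
    (g_gtNy : forall v r, (-oo < g v r)%E)
    (g_dirdiff : forall v, dirdifferentiable (g v)) :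
  let F := tv_functional E w f g in
  let D := @ternary R V in
  (forall x, edom F x -> exists d, minimizes D (dirder F x) d) /\
  forall run : nat -> iteration R V,
    cut_pursuit_run E D F run ->
    solves_reduced F run ->
    exists N, terminates_at F run N /\ stationary F (current_point (run N)).
Proof.
move=> F D; split=> [x _|run hrun hsol]; first exact: ternary_minimizer.
have run_dom k : reached F run k -> edom F (current_point (run k)).
  by move=> /hsol[].
have stop_stationary N : reached F run N -> stops F (run N) ->
    stationary F (current_point (run N)).
  move=> rN sN; have xN := run_dom N rN; split; first exact: xN.
  move=> d; split.
    have [L [_ dL]] :=
      dirder_tv_functional _ _ _ _ _ _ _ f_diff g_gtNy g_dirdiff xN.
    exact: (dL d).1.
  apply: (dirder_tv_functional_ge0 _ _ E w f g _ f_diff g_gtNy g_dirdiff xN).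
  (* The test is made at a minimizer over [D], so it bounds every ternary direction from below by
     0. *)
  move=> s ts; have := (hrun.2 N rN).1.2 s ts; exact: le_trans.
suff [N [rN sN]] : exists N, reached F run N /\ stops F (run N).
  by exists N; split; [split|exact: stop_stationary].
apply: contrapT => /forallNP nostop.
(* A run that never stops reaches every index, so the properties of a step hold at all of them. *)
have allr k : reached F run k.
  by elim/ltn_ind: k => k IH j jk; apply/negP => sj;
    apply: (nostop j); split; [exact: IH|].
have decr k : (#|same_block_pairs (blocks (run k.+1))| <
               #|same_block_pairs (blocks (run k))|)%N.
  rewrite (hrun.2 k (allr k)).2; apply: proper_card.
  (* If the direction is constant on blocks, it is [block_sum delta], and stationarity of the
     reduced functional triggers the stopping test; otherwise some block is split. *)
  have [dP|] := pselect (forall U u v, U \in blocks (run k) ->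
    u \in U -> v \in U -> direction (run k) u = direction (run k) v).
    have [covP tiP] := run_partition _ _ _ _ _ _ k hrun (allr k).
    have [delta dE] := block_constant_block_sum _ _ _ _ covP tiP dP.
    have := (hsol k (allr k)).2 delta; rewrite reduced_dirder -dE => -[_ sk].
    by case: (nostop k).
  move=> /existsNP[U /existsNP[u /existsNP[v]]].
  move=> /not_implyP[UP /not_implyP[uU /not_implyP[vU /eqP duv]]].
  exact: split_partition_pairs_proper UP uU vU duv.
have bound k : (#|same_block_pairs (blocks (run k))| + k <=
                #|same_block_pairs (blocks (run 0%N))|)%N.
  elim: k => [|k IH]; first by rewrite addn0.
  by apply: leq_trans IH; rewrite addnS -addSn leq_add2r.
(* After one more step than there were pairs initially, the bound is violated. *)
have := bound #|same_block_pairs (blocks (run 0%N))|.+1.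
by rewrite addnS ltnNge leq_addl.
Qed.
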